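(* Let $L$ be a principally generated C-lattice and set $m={\rm J}(L)$. The following statements are equivalent. (1) $L$ is an OAFL. (2) $L$ is a COAFL. (3) The join of any two principal elements of $L$ has an OA-factorization. (4) $L$ satisfies one of the following conditions. (a) $L$ is a ZPI-lattice. (b) $L$ is a quasi-local lattice, $m^2$ is comparable and $m$ is a nilpotent element. (c) $L$ is a quasi-local lattice domain, $m^2$ is comparable and $\bigwedge_{n\in\mathbb{N}} m^n=0$.
   Context: A multiplicative lattice is a set $L$ with a commutative associative multiplication and a partial order $\leq$ such that $(L,\leq)$ is a complete lattice with greatest element $1$ and least element $0$, and such that $1x=x$ and $x(\bigvee E)=\bigvee\{xe\mid e\in E\}$ for all $x\in L$ and $E\subseteq L$. An element $a\in L$ is compact if for each $F\subseteq L$ with $a\leq\bigvee F$ there is a finite $E\subseteq F$ with $a\leq\bigvee E$. A subset is multiplicatively closed if it contains $1$ and is closed under products. $L$ is a C-lattice if there is a multiplicatively closed subset $C\subseteq L$ of compact elements such that every element of $L$ is a join of elements of $C$. For $a,b\in L$, $(a:b)=\bigvee\{x\in L\mid xb\leq a\}$. An element $e\in L$ is principal if $a\wedge be=((a:e)\wedge b)e$ and $((a\vee be):e)=(a:e)\vee b$ for all $a,b\in L$. $L$ is principally generated if every element of $L$ is a join of principal elements. An element $a$ is proper if $a<1$; nilpotent if $a^n=0$ for some $n\in\mathbb{N}$; comparable if for each $b\in L$, $a\leq b$ or $b\leq a$. A proper element $m$ is maximal if $m<x\leq 1$ implies $x=1$. ${\rm J}(L)$ is the meet of all maximal elements of $L$.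 A proper element $p$ is prime if for all $a,b\in L$, $ab\leq p$ implies $a\leq p$ or $b\leq p$. $L$ is a lattice domain if $0$ is a prime element. $L$ is quasi-local if $1$ is compact and $L$ has a unique maximal element. A proper element $x$ of a C-lattice $L$ is an OA-element ($1$-absorbing prime element) if for all $a,b,c\in L\setminus\{1\}$, $abc\leq x$ implies $ab\leq x$ or $c\leq x$. An OA-factorization of an element is an expression of it as a finite product of OA-elements (the element $1$ being the empty product). An OAFL (resp. COAFL) is a C-lattice in which every element (resp. every compact element) has an OA-factorization. A ZPI-lattice is a multiplicative lattice in which every element is a finite product of prime elements (the element $1$ being the empty product). *)

(* Defs.v *)
From HB Require Import structures.
From mathcomp Require Import all_boot all_order.
From mathcomp Require Import classical_sets cardinality.

Set Implicit Arguments.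
Unset Strict Implicit.
Unset Printing Implicit Defensive.

Local Open Scope classical_set_scope.
Local Open Scope order_scope.
Local Open Scope group_scope.

(* Completeness is carried by the operation [ljoin], the join of an arbitrary
   set.  The unit of the monoid is the greatest element, so that both are
   written 1.  Distributivity over the empty join gives [x * \bot = \bot]. *)
HB.mixin Record isMultiplicativeLattice d L
    of monoid.Monoid L & Order.TBLattice d L := {
  mulLC : commutative (@monoid.mul L);
  top_eq_one : \top%O = 1%g :> L;
  ljoin : set L -> L;
  ljoinP : forall E : set L, isLub E (ljoin E);
  mul_ljoin : forall (x : L) (E : set L),
    (x * ljoin E)%g = ljoin [set (x * e)%g | e in E]
}.

#[short(type="multLatticeType")]
HB.structure Definition MultiplicativeLattice d :=
  {L of isMultiplicativeLattice d L & monoid.Monoid L & Order.TBLattice d L}.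

Section MultiplicativeLatticeTheory.
Context {d : Order.disp_t} {L : multLatticeType d}.
Implicit Types (a b c e m p x : L) (E F C : set L).

Definition lmeet E : L := ljoin (lbound E).

Definition compact_elt a : Prop :=
  forall F, a <= ljoin F ->
    exists E, [/\ E `<=` F, finite_set E & a <= ljoin E].

Definition mult_closed C : Prop :=
  C 1 /\ (forall a b, C a -> C b -> C (a * b)).

Definition residual a b : L := ljoin [set x | x * b <= a].

Definition principal_elt e : Prop :=
  forall a b,
    a `&` (b * e) = (residual a e `&` b) * e /\
    residual (a `|` (b * e)) e = residual a e `|` b.

Definition proper_elt a : Prop := a < 1.

Definition nilpotent_elt a : Prop := exists n : nat, a ^+ n = \bot.

Definition comparable_elt a : Prop := forall b, a <= b \/ b <= a.

Definition maximal_elt m : Prop :=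
  proper_elt m /\ (forall x, m < x -> x <= 1 -> x = 1).

Definition prime_elt p : Prop :=
  proper_elt p /\ (forall a b, a * b <= p -> a <= p \/ b <= p).

Definition OA_elt x : Prop :=
  proper_elt x /\
  (forall a b c, a <> 1 -> b <> 1 -> c <> 1 ->
    a * b * c <= x -> a * b <= x \/ c <= x).

Definition has_factorization (P : L -> Prop) x : Prop :=
  exists s : seq L, (forall y, y \in s -> P y) /\ x = \prod_(y <- s) y.

Definition has_OA_factorization x : Prop := has_factorization OA_elt x.

End MultiplicativeLatticeTheory.

Section MultiplicativeLatticeClasses.
Context {d : Order.disp_t} (L : multLatticeType d).

Definition C_lattice : Prop :=
  exists C : set L,
    [/\ mult_closed C, C `<=` compact_elt &
        forall x : L, exists2 E : set L, E `<=` C & x = ljoin E].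

Definition principally_generated : Prop :=
  forall x : L, exists2 E : set L, E `<=` principal_elt & x = ljoin E.

Definition jacobson : L := lmeet maximal_elt.

Definition lattice_domain : Prop := prime_elt (\bot : L).

Definition quasi_local : Prop :=
  compact_elt (1 : L) /\ (exists! m : L, maximal_elt m).

Definition OAFL : Prop :=
  C_lattice /\ (forall x : L, has_OA_factorization x).

Definition COAFL : Prop :=
  C_lattice /\ (forall x : L, compact_elt x -> has_OA_factorization x).

Definition ZPI_lattice : Prop :=
  forall x : L, has_factorization prime_elt x.

End MultiplicativeLatticeClasses.

(* Main.v *)
Require Import Defs.
From mathcomp Require Import all_boot all_order.
From mathcomp Require Import classical_sets.
From mathcomp Require Import boolp cardinality.
Import Order.TTheory.

Local Open Scope classical_set_scope.
Local Open Scope order_scope.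
Local Open Scope group_scope.

(* An OA-element is either prime or lies above the product of any two proper
   elements, and the latter, if not prime, forces [L] to be quasi-local. In the
   quasi-local case with maximal element [m], factoring [e `|` f ^+ 3] shows
   that a principal [e] not below [m ^+ 2] lies above [m ^+ 2], hence
   [m ^+ n.+1 = m * e ^+ n], and every nonzero principal element dominates a
   power of [m]. Otherwise joins of two principal elements are products of
   primes. Then, comparing the factorizations of [x `|` g] and [x `|` g ^+ 2],
   no nonzero locally principal prime lies strictly below another prime, so
   that locally at a maximal element [m] every element is [\bot] or a power of
   [m]. As [\bot] is a product of primes, there are finitely many minimal
   primes, and these local data are assembled into a factorization of any
   element. A principally generated C-lattice need not be modular (take a
   non-modular atomistic lattice with a new top element, all products of
   elements other than 1 being 0), so principal elements cannot be transported
   to quotient lattices; only local inequalities in [L] are used. *)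

(** * Arithmetic of multiplicative lattices: products, residuals, principal elements, primes *)

Section Basics.
Set Implicit Arguments.
Unset Strict Implicit.
Unset Printing Implicit Defensive.
Context {d : Order.disp_t} {L : multLatticeType d}.
Implicit Types (a b c e f g m p q r x y z P Q R : L) (E F : set L) (s t : seq L).

Local Notation "\Pi s" := (\prod_(y <- s) y) (at level 20, s at level 9).

Lemma ljoin_ub E x : E x -> x <= ljoin E.
Proof. by case: (ljoinP E) => ub _; exact: ub. Qed.

Lemma ge_ljoin E b : (forall x, E x -> x <= b) -> ljoin E <= b.
Proof. by case: (ljoinP E) => _ lub ubE; exact: lub. Qed.

Lemma lmeet_lb E x : E x -> lmeet E <= x.
Proof. by move=> Ex; apply: ge_ljoin => y; apply. Qed.

Lemma le_lmeet E b : (forall x, E x -> b <= x) -> b <= lmeet E.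
Proof. by move=> lbE; apply: ljoin_ub. Qed.

Lemma lex1g a : a <= 1.
Proof. by rewrite -top_eq_one lex1. Qed.

Lemma le1g_eq a : 1 <= a -> a = 1.
Proof. by move=> a1; apply/le_anti; rewrite lex1g. Qed.

Lemma ljoin2 a b : ljoin [set a; b] = a `|` b.
Proof.
apply/le_anti/andP; split; first by apply: ge_ljoin => x [->|->]; rewrite ?leUl ?leUr.
by rewrite leUx !ljoin_ub //; [right|left].
Qed.

Lemma mulUr c a b : c * (a `|` b) = (c * a) `|` (c * b).
Proof.
rewrite -!ljoin2 mul_ljoin; congr ljoin; apply/seteqP; split=> [x [y [->|->] <-]|x [->|->]].
- by left.
- by right.
- by exists a; [left|].
- by exists b; [right|].
Qed.

Lemma mulUl c a b : (a `|` b) * c = (a * c) `|` (b * c).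
Proof. by rewrite !(mulLC _ c) mulUr. Qed.

Lemma le_mul2l c a b : a <= b -> c * a <= c * b.
Proof. by move/join_r <-; rewrite mulUr leUl. Qed.

Lemma le_mul2r c a b : a <= b -> a * c <= b * c.
Proof. by rewrite !(mulLC _ c); exact: le_mul2l. Qed.

Lemma le_mul a b a' b' : a <= a' -> b <= b' -> a * b <= a' * b'.
Proof. by move=> aa' bb'; exact: le_trans (le_mul2r _ aa') (le_mul2l _ bb'). Qed.

Lemma mul_lel a b : a * b <= a.
Proof. by rewrite -[leRHS]mulg1 le_mul2l // lex1g. Qed.

Lemma mul_ler a b : a * b <= b.
Proof. by rewrite mulLC mul_lel. Qed.

Lemma mul_ljoinl E x b : (forall y, E y -> y * b <= x) -> ljoin E * b <= x.
Proof.
move=> Eb; rewrite mulLC mul_ljoin; apply: ge_ljoin => _ [y Ey <-].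
by rewrite mulLC Eb.
Qed.

Lemma mul0l a : \bot * a = \bot.
Proof.
apply/eqP; rewrite -lex0 mulLC; apply: le_trans (mul_ler _ _) _; exact: lexx.
Qed.

Lemma residualP x a b : (x <= residual a b) = (x * b <= a).
Proof.
apply/idP/idP => [xr|xb]; last exact: ljoin_ub.
by apply: le_trans (le_mul2r _ xr) _; exact: mul_ljoinl.
Qed.

Lemma residual_mul a b : residual a b * b <= a.
Proof. by rewrite -residualP. Qed.

Lemma residual_eq1 a b : b <= a -> residual a b = 1.
Proof. by move=> ba; apply: le1g_eq; rewrite residualP mul1g. Qed.

Lemma residualM a e f : residual a (e * f) = residual (residual a f) e.
Proof.
apply/le_anti/andP; split; first by rewrite !residualP -mulgA residual_mul.
by rewrite residualP mulgA -!residualP.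
Qed.

Lemma le_residual2l a b e : a <= b -> residual a e <= residual b e.
Proof. by move=> ab; rewrite residualP (le_trans (residual_mul _ _)). Qed.

Lemma le_residual a e : a <= residual a e.
Proof. by rewrite residualP mul_lel. Qed.

(** The meet half of principality at [b = 1]: what lies below [e] is a multiple of [e]. *)
Lemma principal_le e a : principal_elt e -> a <= e -> a = residual a e * e.
Proof.
move=> pe ae; have [+ _] := pe a 1; rewrite mul1g -top_eq_one meetx1.
by move: ae; rewrite leEmeet => /eqP ->.
Qed.

Lemma principal_residual e a b :
  principal_elt e -> residual (a `|` b * e) e = residual a e `|` b.
Proof. by move=> pe; case: (pe a b). Qed.

Lemma principal_bot : principal_elt (\bot : L).
Proof.
move=> a b; rewrite -!(mulLC \bot) !mul0l meetx0 joinx0; split=> //.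
by rewrite !residual_eq1 ?le0x // -top_eq_one join1x.
Qed.

Lemma principal_one : principal_elt (1 : L).
Proof.
have r1 a : residual a 1 = a.
  by apply/le_anti; rewrite le_residual andbT -[leLHS]mulg1 residual_mul.
by move=> a b; rewrite !mulg1 !r1.
Qed.

Lemma principal_mul e f : principal_elt e -> principal_elt f -> principal_elt (e * f).
Proof.
move=> pe pf a b; split.
  by rewrite mulgA (pf a _).1 (pe _ b).1 residualM !mulgA.
by rewrite mulgA residualM (pf a _).2 (pe _ b).2 residualM.
Qed.

Lemma principal_exp e n : principal_elt e -> principal_elt (e ^+ n).
Proof.
move=> pe; elim: n => [|n IHn]; first by rewrite expg0; exact: principal_one.
by rewrite expgS; exact: principal_mul.
Qed.

Lemma prod_cons x s : \Pi (x :: s) = x * \Pi s.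
Proof. by rewrite big_cons. Qed.

Lemma prod_cat s t : \Pi (s ++ t) = \Pi s * \Pi t.
Proof. by rewrite big_cat. Qed.

Lemma prod_rem x s : x \in s -> \Pi s = x * \Pi (rem x s).
Proof.
elim: s => //= y s IHs; rewrite inE prod_cons.
have [->//|ne] := eqVneq y x; move=> /= /IHs ->.
by rewrite prod_cons !mulgA (mulLC x).
Qed.

Lemma prod_filter (P : pred L) s :
  \Pi s = \Pi [seq y <- s | P y] * \Pi [seq y <- s | ~~ P y].
Proof.
elim: s => [|y s IHs]; first by rewrite !big_nil mulg1.
rewrite /= prod_cons IHs; case: (P y) => /=; rewrite prod_cons ?mulgA //.
by rewrite (mulLC y).
Qed.

Lemma prod_nseq n x : \Pi (nseq n x) = x ^+ n.
Proof. by elim: n => [|n IHn] /=; rewrite ?big_nil ?prod_cons ?IHn ?expgS. Qed.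

Lemma prod_const x s : (forall y, y \in s -> y = x) -> \Pi s = x ^+ size s.
Proof.
elim: s => [|y s IHs] sx; first by rewrite big_nil.
rewrite prod_cons expgS (sx y) ?mem_head // IHs // => z zs.
by apply: sx; rewrite inE zs orbT.
Qed.

Lemma prod_le x s : x \in s -> \Pi s <= x.
Proof. by move=> /prod_rem ->; exact: mul_lel. Qed.

Lemma le_exp x k n : (k <= n)%N -> x ^+ n <= x ^+ k.
Proof. by move=> /subnKC <-; rewrite expgnDr mul_lel. Qed.

Lemma has_factorizationM (T : L -> Prop) x y :
  has_factorization T x -> has_factorization T y -> has_factorization T (x * y).
Proof.
move=> [s [sT ->]] [t [tT ->]]; exists (s ++ t); rewrite prod_cat; split=> // z.
by rewrite mem_cat => /orP[/sT|/tT].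
Qed.

Lemma has_factorization1 (T : L -> Prop) : has_factorization T 1.
Proof. by exists [::]; rewrite big_nil. Qed.

Lemma has_factorizationW (T : L -> Prop) x : T x -> has_factorization T x.
Proof.
by move=> Tx; exists [:: x]; rewrite prod_cons big_nil mulg1; split=> // y /[!inE] /eqP ->.
Qed.

Lemma has_factorizationX (T : L -> Prop) x n :
  has_factorization T x -> has_factorization T (x ^+ n).
Proof.
move=> Tx; elim: n => [|n IHn]; first exact: has_factorization1.
by rewrite expgS; exact: has_factorizationM.
Qed.

Lemma prime_neq1 p : prime_elt p -> ~ 1 <= p.
Proof. by move=> [p1 _] /le1g_eq pE; move: p1; rewrite /proper_elt pE ltxx. Qed.

Lemma properP x : proper_elt x <-> x <> 1.
Proof.
split=> [x1 xE|/eqP x1]; last by rewrite /proper_elt lt_neqAle x1 lex1g.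
by move: x1; rewrite /proper_elt xE ltxx.
Qed.

Lemma prime_mul p a b : prime_elt p -> a * b <= p -> ~ a <= p -> b <= p.
Proof. by move=> [_ pp] /pp []. Qed.

Lemma prime_prod p s : prime_elt p -> \Pi s <= p -> exists2 y, y \in s & y <= p.
Proof.
move=> pp; elim: s => [|y s IHs]; first by rewrite big_nil => /(prime_neq1 pp).
rewrite prod_cons => /pp.2 [yp|/IHs [z zs zp]]; first by exists y; rewrite ?mem_head.
by exists z; rewrite ?inE ?zs ?orbT.
Qed.

Lemma prime_exp p x n : prime_elt p -> x ^+ n <= p -> x <= p.
Proof.
by move=> pp; rewrite -prod_nseq => /(prime_prod pp) [y /nseqP [-> _]].
Qed.

Lemma maximal_le m x : maximal_elt m -> proper_elt x -> m <= x -> x = m.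
Proof.
move=> [_ mm] /properP x1; rewrite le_eqVlt => /orP[/eqP //|mx].
by case: x1; apply: mm; rewrite ?lex1g.
Qed.

Lemma maximal_prime m : maximal_elt m -> prime_elt m.
Proof.
move=> mm; split; first exact: mm.1.
move=> a b abm; have [am|/negP am] := boolP (a <= m); [by left|right].
have [am1|/eqP/properP am1] := eqVneq (a `|` m) 1.
  by rewrite -[b]mul1g -am1 mulUl leUx abm mul_lel.
by case: am; rewrite -(maximal_le mm am1) ?leUl ?leUr.
Qed.

Lemma prime_OA p : prime_elt p -> OA_elt p.
Proof. by move=> [p1 pp]; split=> // a b c _ _ _; exact: pp. Qed.

Lemma minimal_below s x :
  x \in s -> exists y, [/\ y \in s, y <= x & forall z, z \in s -> z <= y -> z = y].
Proof.
elim: s x => // y s IHs x; rewrite inE => xys.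
have [[w ws wx]|nw] := pselect (exists2 w, w \in s & w <= x).
  have [z [zs zw zmin]] := IHs w ws.
  have [yz|nyz] := boolP (y <= z).
    exists y; split=> [||v]; rewrite ?mem_head //; first exact: le_trans yz (le_trans zw wx).
    rewrite inE => /orP[/eqP //|vs] vy; apply/le_anti; rewrite vy /=.
    by rewrite (zmin v vs (le_trans vy yz)).
  exists z; split=> [||v]; [by rewrite inE zs orbT|exact: le_trans wx|].
  by rewrite inE => /orP[/eqP ->|/zmin //]; rewrite (negPf nyz).
have {}xys : x = y by case/orP: xys => [/eqP //|xs]; case: nw; exists x.
rewrite {x}xys in nw *.
exists y; split=> [||v]; rewrite ?mem_head // inE => /orP[/eqP //|vs] vy.
by case: nw; exists v.
Qed.

End Basics.

(** * Compactness of principal elements and existence of maximal elements *)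

Section PrincipallyGenerated.
Set Implicit Arguments.
Unset Strict Implicit.
Unset Printing Implicit Defensive.
Context {d : Order.disp_t} {L : multLatticeType d}.
Context (HC : C_lattice L) (Hpg : principally_generated L).
Implicit Types (a b c e f g m p q r x y z P Q R : L) (E F : set L) (s t : seq L).

Local Notation "\Pi s" := (\prod_(y <- s) y) (at level 20, s at level 9).

Lemma compact_directed e F : compact_elt e -> F \bot ->
  (forall x y, F x -> F y -> F (x `|` y)) -> e <= ljoin F -> exists2 x, F x & e <= x.
Proof.
move=> ce F0 FU /ce [E [EF /finite_seqP [s Es] eE]].
suff [x Fx sx] : exists2 x, F x & forall y, y \in s -> y <= x.
  exists x => //; apply: le_trans eE _; apply: ge_ljoin => y; rewrite Es => ys.
  exact: sx.
have : forall y, y \in s -> F y by move=> y ys; apply: EF; rewrite Es.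
elim: s {E EF Es eE} => [|y s IHs] sF; first by exists \bot.
have [|x Fx sx] := IHs; first by move=> z zs; apply: sF; rewrite inE zs orbT.
exists (y `|` x); first by apply: FU => //; apply: sF; exact: mem_head.
move=> z; rewrite inE => /orP[/eqP ->|/sx zx]; first exact: leUl.
exact: le_trans zx (leUr _ _).
Qed.

Lemma compact_join a b : compact_elt a -> compact_elt b -> compact_elt (a `|` b).
Proof.
move=> ca cb F; rewrite leUx => /andP[/ca [D [DF Df aD]] /cb [E [EF Ef bE]]].
exists (D `|` E)%classic; split; [by move=> x [/DF|/EF]|by rewrite finite_setU|].
rewrite leUx; apply/andP; split; [apply: le_trans aD _|apply: le_trans bE _];
  apply: ge_ljoin => x xD; apply: ljoin_ub; by [left|right].
Qed.

Lemma compact_one : compact_elt (1 : L).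
Proof. by have [C [[C1 _] Ccomp _]] := HC; exact: Ccomp. Qed.

(** As [e] is a join of compact elements, each below a finite join from [F], one gets
    [e <= ljoin G * e]. The join half of principality turns this into [1 <= ljoin G], and
    compactness of 1 puts 1 below a member of [G]. *)
Lemma principal_compact e : principal_elt e -> compact_elt e.
Proof.
move=> pe F eF; have [C [_ Ccomp Cgen]] := HC.
pose G : set L := [set x | exists E, [/\ E `<=` F, finite_set E & x <= residual (ljoin E) e]].
have G0 : G (residual \bot e).
  by exists set0; split=> //; exact: le_residual2l (le0x _).
have eG : e <= ljoin G * e.
  have [E EC eE] := Cgen e; rewrite {1}eE; apply: ge_ljoin => c Ec.
  have ce : c <= e by rewrite eE; exact: ljoin_ub.
  have [D [DF Dfin cD]] := Ccomp _ (EC _ Ec) F (le_trans ce eF).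
  have ceD : c <= e `&` ljoin D by rewrite lexI ce.
  apply: le_trans ceD _; rewrite (principal_le pe (leIl _ _)) le_mul2r //.
  by apply: ljoin_ub; exists D; split=> //; apply: le_residual2l; exact: leIr.
have G1 : 1 <= ljoin G.
  have <- : residual (ljoin G * e) e = 1 by apply: residual_eq1.
  rewrite -[_ * e]join0x principal_residual // leUx lexx andbT; exact: ljoin_ub.
have [||x [D [DF Df xD]] /le1g_eq xE] := @compact_directed 1 G compact_one _ _ G1.
- by exists set0; split=> //; rewrite le0x.
- move=> x y [D [DF Df xD]] [D' [D'F D'f yD]]; exists (D `|` D'); split.
  + by move=> z [/DF|/D'F].
  + by rewrite finite_setU.
  + rewrite leUx; apply/andP; split; [apply: le_trans xD _|apply: le_trans yD _];
    apply: le_residual2l; apply: ge_ljoin => z Dz; apply: ljoin_ub; [by left|by right].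
- exists D; split=> //.
  by rewrite -[e]mul1g -residualP -xE.
Qed.

Lemma le_principal a b : (forall e, principal_elt e -> e <= a -> e <= b) -> a <= b.
Proof.
have [E Ep ->] := Hpg a => ab; apply: ge_ljoin => x Ex.
by apply: ab; [exact: Ep|exact: ljoin_ub].
Qed.

Lemma nle_principal a b : ~ a <= b -> exists e, [/\ principal_elt e, e <= a & ~ e <= b].
Proof.
move=> nab; apply: contrapT => ne; apply: nab; apply: le_principal => e pe ea.
by apply: contrapT => neb; apply: ne; exists e.
Qed.

Lemma maximal_above a : proper_elt a -> exists2 m, maximal_elt m & a <= m.
Proof.
move=> a1; pose T := {x : L | (a <= x) && (x < 1)}.
pose R := fun u v : T => val u <= val v.
have [|||A tA|m mmax] := @Zorn T R.
- by move=> u; exact: lexx.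
- by move=> u v w; exact: le_trans.
- by move=> u v uv vu; apply/val_inj/le_anti/andP.
(* Elements below [a] are included so that [F] contains [\bot] even for an empty chain. *)
- pose F : set L := [set x | x <= a \/ exists2 u, A u & x <= val u].
  have F1 : ljoin F < 1.
    apply/properP => FE.
    have [|||x [xa|[u Au xu]] x1] := @compact_directed 1 F compact_one.
    + by left; exact: le0x.
    + move=> x y [xa|[u Au xu]] [ya|[v Av yv]]; first by left; rewrite leUx xa.
      * by right; exists v => //; rewrite leUx yv (le_trans xa) //; case/andP: (valP v).
      * by right; exists u => //; rewrite leUx xu (le_trans ya) //; case/andP: (valP u).
      * right; have [uv|uv] := tA u v Au Av; [exists v|exists u] => //.
          by rewrite leUx yv (le_trans xu).
        by rewrite leUx xu (le_trans yv).
    + by rewrite FE.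
    + by move: a1; rewrite /proper_elt (le_gtF (le_trans x1 xa)).
    + by have /andP[_] := valP u; rewrite (le_gtF (le_trans x1 xu)).
  have Ft : (a <= ljoin F) && (ljoin F < 1).
    by rewrite F1 andbT; apply: ljoin_ub; left.
  exists (exist _ (ljoin F) Ft : T) => u Au.
  by apply: ljoin_ub; right; exists u.
- have /andP[am m1] := valP m; exists (val m) => //; split=> // x mx _.
  apply: contrapT => /properP x1.
  have Tx : (a <= x) && (x < 1) by rewrite (le_trans am (ltW mx)).
  have /(congr1 val) /= xm := mmax (exist _ x Tx : T) (ltW mx).
  by rewrite xm ltxx in mx.
Qed.

(* [a <= loc m b] compares [a] and [b] in the localization of [L] at [m];
   for [e] principal it means that [residual b e] is not below [m]. *)
Definition loc m b : L := ljoin [set x | ~ residual b x <= m].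

(** * Nakayama's lemma and cancellation in the localization at a prime element *)

Section Localization.
Context (m : L) (mp : prime_elt m).

Local Notation "a <~ b" := (a <= loc m b) (at level 70, no associativity).

(** Primality of [m] makes the set whose join is [loc m b] closed under binary joins, so compactness
    of [e] puts [e] below one of its members. *)
Lemma principal_le_loc e b : principal_elt e -> e <~ b <-> ~ residual b e <= m.
Proof.
move=> pe; split=> [eb|nbe]; last exact: ljoin_ub.
have [||x nx ex] := compact_directed (principal_compact pe) _ _ eb.
- by move=> /= ; rewrite residual_eq1 ?le0x //; exact: prime_neq1.
- move=> x y /= nx ny; apply: contra_not nx => xym.
  apply: contrapT => nx; apply: ny; apply: (prime_mul mp _ nx).
  apply: le_trans xym; rewrite residualP mulUr leUx; apply/andP; split.
    by rewrite mulLC mulgA (le_trans (mul_lel _ _)) // mulLC residual_mul.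
  by rewrite -mulgA (le_trans (mul_ler _ _)) // residual_mul.
- apply: contra_not nx => /(le_trans _) -> //.
  by rewrite residualP (le_trans (le_mul2l _ ex)) // residual_mul.
Qed.

Lemma le_locP a b :
  a <~ b <-> (forall e, principal_elt e -> e <= a -> ~ residual b e <= m).
Proof.
split=> [ab e pe ea|ab]; first by apply/principal_le_loc => //; exact: le_trans ab.
by apply: le_principal => e pe ea; apply/principal_le_loc/ab.
Qed.

Lemma loc_le a b : a <= b -> a <~ b.
Proof. by move=> ab; apply: ljoin_ub => /=; rewrite residual_eq1 //; exact: prime_neq1. Qed.

Lemma loc_refl a : a <~ a.
Proof. exact: loc_le. Qed.

Lemma loc_trans b a c : a <~ b -> b <~ c -> a <~ c.
Proof.
move=> /le_locP ab /le_locP bc; apply/le_locP => e pe ea rm.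
have [s [ps sb nsm]] := nle_principal (ab e pe ea).
have se : s * e <= b by rewrite -residualP.
apply: (bc _ (principal_mul ps pe) se); apply: prime_mul mp _ nsm.
by apply: le_trans rm; rewrite residualP (mulLC s) -mulgA residual_mul.
Qed.

Lemma loc_mul2l c a b : a <~ b -> c * a <~ c * b.
Proof.
move=> ab; apply: le_trans (le_mul2l _ ab) _; rewrite mulLC; apply: mul_ljoinl => x /= nx.
apply: ljoin_ub => /=; apply: contra_not nx; apply: le_trans.
by rewrite residualP mulgA (mulLC _ c) le_mul2l // ?residual_mul //.
Qed.

Lemma loc_mul2r c a b : a <~ b -> a * c <~ b * c.
Proof. by rewrite !(mulLC _ c); exact: loc_mul2l. Qed.

Lemma loc_mul a b a' b' : a <~ a' -> b <~ b' -> a * b <~ a' * b'.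
Proof. by move=> aa' bb'; apply: loc_trans (loc_mul2r _ aa') (loc_mul2l _ bb'). Qed.

Lemma loc_join a b c : a <~ c -> b <~ c -> a `|` b <~ c.
Proof. by rewrite leUx => -> ->. Qed.

Lemma loc_unit a u : ~ u <= m -> a <~ a * u.
Proof.
move=> num; apply: ljoin_ub => /=; apply: contra_not num; apply: le_trans.
by rewrite residualP mulLC.
Qed.

Lemma loc_prime a p : prime_elt p -> p <= m -> a <~ p -> a <= p.
Proof.
move=> pp pm /le_locP ap; apply: le_principal => e pe ea.
apply: (prime_mul pp (residual_mul p e)) => rp; apply: (ap e pe ea).
exact: le_trans pm.
Qed.

(** Dividing by [e] yields the join of [residual a e] and [x]; since [x <= m], the first of them
    alone must escape [m]. *)
Lemma loc_Nakayama e a x :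
  principal_elt e -> x <= m -> e <~ a `|` x * e -> e <~ a.
Proof.
move=> pe xm /(principal_le_loc _ pe); rewrite principal_residual // leUx xm andbT.
by move/(principal_le_loc _ pe).
Qed.

Lemma loc_Nakayama0 e x : principal_elt e -> x <= m -> e <~ x * e -> e <~ \bot.
Proof. by move=> pe xm exe; apply: (loc_Nakayama pe xm); rewrite join0x. Qed.

(** Primality of [Q] gives [residual Q g = Q], so dividing by [g] leaves [Q] unchanged. *)
Lemma loc_cancel Q g a b : prime_elt Q -> Q <= m -> principal_elt g -> ~ g <= Q ->
  g * a <~ Q `|` g * b -> a <~ Q `|` b.
Proof.
move=> Qp Qm pg ngQ /le_locP gab; apply/le_locP => e pe ea.
have := gab _ (principal_mul pg pe) (le_mul2l _ ea).
rewrite (mulLC g e) residualM (mulLC g b) principal_residual //.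
suff -> : residual Q g = Q by [].
apply/le_anti; rewrite le_residual andbT.
by apply: (prime_mul Qp _ ngQ); rewrite mulLC residual_mul.
Qed.

(** If no principal [x <= P] worked, each [x * R] would be a multiple of [f] by an element below
    [m]; joining over [x] gives [f <= m * f], against Nakayama's lemma. *)
Lemma loc_principal_factor f P R : principal_elt f -> f = P * R -> ~ f <~ \bot ->
  exists x, [/\ principal_elt x, x <= P & f <~ x * R].
Proof.
move=> pf fPR nf; apply: contrapT => nx; apply: nf.
apply: (loc_Nakayama0 pf (lexx m)); apply: loc_le.
have [E Ep PE] := Hpg P; rewrite {1}fPR PE; apply: mul_ljoinl => x Ex.
have xP : x <= P by rewrite PE; exact: ljoin_ub.
have xRf : x * R <= f by rewrite fPR le_mul2r.
rewrite (principal_le pf xRf) le_mul2r //; apply: contrapT => nr.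
by apply: nx; exists x; split=> //; [exact: Ep|apply/principal_le_loc].
Qed.

Lemma loc_prod_filter s : \Pi [seq y <- s | y <= m] <~ \Pi s.
Proof.
rewrite (prod_filter (fun y => y <= m) s); apply: loc_unit => /(prime_prod mp) [y].
by rewrite mem_filter => /andP[/negP].
Qed.

Lemma le_prod_filter s : \Pi s <= \Pi [seq y <- s | y <= m].
Proof. by rewrite (prod_filter (fun y => y <= m) s) mul_lel. Qed.

(* A minimal factor of [s] also occurs in [t], and can then be cancelled. *)
Lemma loc_prod_unique Q s t :
  (forall y, y \in s -> [/\ prime_elt y, Q <= y, y <= m &
     forall a b, y * a <~ Q `|` y * b -> a <~ Q `|` b]) ->
  (forall y, y \in t -> [/\ prime_elt y, Q <= y & y <= m]) ->
  \Pi s <~ Q `|` \Pi t -> \Pi t <~ Q `|` \Pi s -> \Pi t <= \Pi s.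
Proof.
have [n] := ubnP (size s); elim: n s t => // n IHn [|x s'] t.
  by move=> *; rewrite big_nil lex1g.
set s := x :: s'; move=> sn sP tP st ts.
have [y [ys _ ymin]] := minimal_below (mem_head x s' : x \in s).
have [yp Qy ym yc] := sP y ys.
have [z zt zy] : exists2 z, z \in t & z <= y.
  apply: (prime_prod yp); apply: (loc_prime yp ym); apply: (loc_trans ts).
  by apply/loc_le; rewrite leUx Qy prod_le.
have [zp Qz zm] := tP z zt.
have [w ws wz] : exists2 w, w \in s & w <= z.
  apply: (prime_prod zp); apply: (loc_prime zp zm).
  by apply: (loc_trans st); apply/loc_le; rewrite leUx Qz prod_le.
have wy := ymin w ws (le_trans wz zy).
have zyE : z = y by apply/le_anti; rewrite zy -{1}wy.
rewrite zyE in zt; rewrite (prod_rem ys) (prod_rem zt); apply: le_mul2l.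
rewrite (prod_rem ys) (prod_rem zt) in st ts.
apply: IHn.
- by rewrite size_rem.
- by move=> v /mem_rem /sP.
- by move=> v /mem_rem /tP.
- exact: yc.
- exact: yc.
Qed.

End Localization.

(** * Prime factorization when joins of two principal elements are products of primes *)

Section PrimeFactorization.
Context (H2 : forall a b, principal_elt a -> principal_elt b ->
  has_factorization prime_elt (a `|` b)).

Definition minimal_prime P := prime_elt P /\ forall q, prime_elt q -> q <= P -> q = P.

Lemma principal_factorization e : principal_elt e -> has_factorization prime_elt e.
Proof. by move=> pe; rewrite -[e](joinxx e); exact: H2. Qed.

Lemma minimal_prime_factors : exists s, (forall p, p \in s -> prime_elt p) /\
  forall q, prime_elt q -> exists P, [/\ P \in s, minimal_prime P & P <= q].
Proof.
have [s [sp s0]] := principal_factorization principal_bot; exists s; split=> // q qp.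
have [|x xs xq] := prime_prod (s := s) qp; first by rewrite -s0 le0x.
have [P [Ps Px Pmin]] := minimal_below xs; exists P; split=> //; last exact: le_trans xq.
split=> [|r rp rP]; first exact: sp.
have [|y ys yr] := prime_prod (s := s) rp; first by rewrite -s0 le0x.
by apply/le_anti; rewrite rP -{1}(Pmin y ys (le_trans yr rP)).
Qed.

(** * Primes and powers in the localization at a prime [m] *)

Section Local.
Context (m : L) (mp : prime_elt m).

(** By minimality, a principal element below [P] has [P] itself as a prime factor. Writing
    [f = P * R] and [x = P * T], the bound [T <= m] would give [f <= T * f] locally, so [T] is a
    local unit. *)
Lemma loc_principal_minimal_prime P f :
  minimal_prime P -> P <= m -> principal_elt f -> f <= P -> ~ f <= loc m \bot ->
  exists x, [/\ principal_elt x, x <= P, P <= loc m x & ~ x <= loc m \bot].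
Proof.
move=> [Pp Pmin] Pm pf fP nf.
have divP e : principal_elt e -> e <= P -> exists R, e = P * R.
  move=> pe eP; have [s [sp es]] := principal_factorization pe.
  have [|y ys yP] := prime_prod (s := s) Pp; first by rewrite -es.
  by exists (\Pi (rem y s)); rewrite es (prod_rem ys) (Pmin y (sp y ys) yP).
have [R fE] := divP f pf fP.
have [x [px xP fx]] := loc_principal_factor mp pf fE nf.
have [T xE] := divP x px xP.
exists x; split=> //; last first.
  move=> x0; apply: nf; apply: (loc_trans mp fx).
  by apply: (loc_trans mp (loc_mul2r _ x0)); rewrite mul0l loc_refl.
rewrite xE; apply: loc_unit => Tm; apply: nf; apply: (loc_Nakayama0 mp pf Tm).
by rewrite {2}fE mulgA (mulLC T) -xE.
Qed.

(* Compare the factorizations of [x `|` g] and [x `|` g ^+ 2]: modulo [Q] the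
   second is the square of the first, so that [x <= (x `|` g) ^+ 2] locally,
   which Nakayama's lemma forbids. *)
Lemma loc_principal_prime_max Q x :
  prime_elt Q -> Q <= m -> principal_elt x -> x <= Q -> Q <= loc m x ->
  ~ x <= loc m \bot -> Q = m.
Proof.
move=> Qp Qm px xQ Qx nx; apply: contrapT => Qnm.
have [|g [pg gm gQ]] := @nle_principal m Q.
  by move=> mQ; apply: Qnm; apply/le_anti; rewrite Qm mQ.
have pgg := principal_mul pg pg.
have [s0 [s0p sE]] := H2 px pg.
have [t0 [t0p tE]] := H2 px pgg.
pose s := [seq y <- s0 | y <= m]; pose t := [seq y <- t0 | y <= m].
have aboveQ y : prime_elt y -> y <= m -> x <= y -> Q <= y.
  by move=> yp ym xy; apply: (loc_prime mp yp ym); apply: (loc_trans mp Qx); exact: loc_le.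
have sP y : y \in s -> [/\ prime_elt y, Q <= y & y <= m].
  rewrite mem_filter => /andP[ym ys]; have yp := s0p y ys; split=> //.
  by apply: aboveQ => //; apply: le_trans (leUl _ g) _; rewrite sE prod_le.
have tP y : y \in t -> [/\ prime_elt y, Q <= y & y <= m].
  rewrite mem_filter => /andP[ym yt]; have yp := t0p y yt; split=> //.
  by apply: aboveQ => //; apply: le_trans (leUl _ (g * g)) _; rewrite tE prod_le.
have s_le : \Pi s <= loc m (x `|` g) by rewrite sE; exact: loc_prod_filter.
have le_s : x `|` g <= \Pi s by rewrite sE; exact: le_prod_filter.
have t_le : \Pi t <= loc m (x `|` g * g) by rewrite tE; exact: loc_prod_filter.
have le_t : x `|` g * g <= \Pi t by rewrite tE; exact: le_prod_filter.
have sq_le : (x `|` g) * (x `|` g) <= x `|` g * g.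
  rewrite mulUr !mulUl !leUx leUr andbT -andbA; apply/and3P; split.
  - exact: le_trans (mul_lel _ _) (leUl _ _).
  - exact: le_trans (mul_ler _ _) (leUl _ _).
  - exact: le_trans (mul_lel _ _) (leUl _ _).
have xss : x <= loc m ((x `|` g) * (x `|` g)).
  apply: (loc_trans mp _ (loc_mul mp s_le s_le)).
  apply: loc_le => //; apply: le_trans (leUl _ (g * g)) (le_trans le_t _).
  rewrite -prod_cat; apply: (loc_prod_unique mp (Q := Q)) => //.
  (* [y] divides an element locally equal to the join of [x] and [g], which is [g] modulo [Q]; so
     cancelling [y] reduces to cancelling [g]. *)
  - move=> y; rewrite mem_cat orbb => ys; have [yp Qy ym] := sP y ys; split=> // a b yab.
    apply: (loc_cancel mp Qp Qm pg gQ).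
    have sab : \Pi s * a <= loc m (Q `|` \Pi s * b).
      rewrite (prod_rem ys) (mulLC y) -!mulgA.
      apply: (loc_trans mp (loc_mul2l _ yab)); apply: loc_le => //.
      by rewrite mulUr leU2 // mul_ler.
    apply: (loc_trans mp _ (loc_trans mp sab _)).
      by apply: loc_le => //; rewrite le_mul2r // (le_trans _ le_s) // leUr.
    apply: loc_join; first by apply: loc_le => //; exact: leUl.
    apply: (loc_trans mp (loc_mul2r _ s_le)); apply: loc_le => //.
    by rewrite mulUl leU2 // (le_trans (mul_lel _ _)).
  - rewrite prod_cat; apply: (loc_trans mp (loc_mul mp s_le s_le)); apply: loc_le => //.
    by apply: (le_trans sq_le); apply: (le_trans le_t); exact: leUr.
  - rewrite prod_cat; apply: (loc_trans mp t_le); apply: loc_le => //.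
    by rewrite leU2 // le_mul // (le_trans (leUr g x)).
(* The terms of the square other than [g * g] are multiples of [x] by elements below [m], which
   Nakayama's lemma removes. *)
have xgg : x <= loc m (g * g).
  apply: (loc_Nakayama mp px (x := x `|` g)); first by rewrite leUx gm (le_trans xQ).
  apply: (loc_trans mp xss); apply: loc_le => //.
  rewrite mulUr leUx; apply/andP; split; first exact: leUr.
  by rewrite !mulUl !leUx leUl andbT (mulLC x g) lexU2 // leUr orbT.
(* For a local unit [u], [x * u] is a multiple of [g * g]. Primality of [Q] puts the cofactor below
   [Q], hence locally below [x], so that [x <= g * g * x] locally. *)
apply: nx; apply: (loc_Nakayama0 mp px (x := g * g)); first exact: le_trans (mul_lel _ _) gm.
have /(principal_le_loc mp _ px) nr := xgg.
apply: (loc_trans mp (loc_unit x nr)).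
set u := residual _ _ in nr *.
have xu : x * u <= g * g by rewrite mulLC residual_mul.
rewrite (principal_le pgg xu) mulLC; apply: loc_mul2l => //.
apply: (loc_trans mp _ Qx); apply: loc_le => //.
apply: (prime_mul Qp (a := g * g)).
  by rewrite mulLC -(principal_le pgg xu); exact: le_trans (mul_lel _ _) xQ.
by move/Qp.2 => [].
Qed.

Lemma minimal_prime_loc0 P : minimal_prime P -> P <= m -> P <> m -> P <= loc m \bot.
Proof.
move=> Pmin Pm Pnm; apply: le_principal => f pf fP; apply: contrapT => nf; apply: Pnm.
have [x [px xP Px nx]] := loc_principal_minimal_prime Pmin Pm pf fP nf.
exact: (loc_principal_prime_max Pmin.1 Pm px xP Px nx).
Qed.

(** A principal [g <= q] not below [P] has a prime factor [r <= q]. Cancelling [g] modulo the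
    locally zero [P] shows that [r] is locally principal and nonzero, so [r = m] and [q = m]. *)
Lemma prime_above_minimal P q : minimal_prime P -> P <= loc m \bot ->
  prime_elt q -> P <= q -> q <= m -> q = P \/ q = m.
Proof.
move=> [Pp Pmin] P0 qp Pq qm.
have [qP|/negP/nle_principal [g [pg gq gP]]] := boolP (q <= P).
  by left; apply/le_anti; rewrite qP.
right; have Pm := le_trans Pq qm.
have [s [sp gE]] := principal_factorization pg.
have [|r rs rq] := prime_prod (s := s) qp; first by rewrite -gE.
have rp := sp r rs; have rm := le_trans rq qm.
rewrite (prod_rem rs) in gE; set R := \Pi _ in gE.
have ng : ~ g <= loc m \bot.
  move=> g0; apply: gP; apply: (loc_prime mp Pp Pm); apply: (loc_trans mp g0).
  by apply: loc_le => //; exact: le0x.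
have [y [py yr gy]] := loc_principal_factor mp pg gE ng.
suff rE : r = m by apply/le_anti; rewrite qm -{1}rE rq.
apply: (loc_principal_prime_max rp rm py yr); last first.
  move=> y0; apply: ng; apply: (loc_trans mp gy).
  by apply: (loc_trans mp (loc_mul2r _ y0)); rewrite mul0l loc_refl.
apply: (loc_trans mp (b := P `|` y)); last first.
  apply: loc_join; last exact: loc_refl.
  by apply: (loc_trans mp P0); apply: loc_le => //; exact: le0x.
apply: (loc_cancel mp Pp Pm pg gP); apply: (loc_trans mp (b := g * y)); last first.
  by apply: loc_le => //; exact: leUr.
rewrite mulLC; apply: (loc_trans mp (loc_mul2l r gy)); apply: loc_le => //.
by rewrite mulgA (mulLC r) -mulgA -gE mulLC.
Qed.

(** A minimal prime strictly below [m] vanishes locally, hence lies below every prime under [m]. *)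
Lemma loc_structure :
  (forall q, prime_elt q -> q <= m -> q = m) \/
  exists P, [/\ minimal_prime P, P <= m, P <> m, P <= loc m \bot &
    forall q, prime_elt q -> q <= m -> q = P \/ q = m].
Proof.
have [s [_ smin]] := minimal_prime_factors.
have [P [_ Pmin Pm]] := smin m mp.
have [PE|Pnm] := pselect (P = m); [left|right].
  by move=> q qp qm; rewrite -PE; apply: Pmin.2; rewrite ?PE.
have P0 := minimal_prime_loc0 Pmin Pm Pnm.
exists P; split=> // q qp qm; have [P' [_ P'min P'q]] := smin q qp.
have P'm := le_trans P'q qm.
apply: prime_above_minimal => //; suff -> : P = P' by [].
apply: P'min.2 Pmin.1 _; apply: (loc_prime mp P'min.1 P'm); apply: (loc_trans mp P0).
by apply: loc_le => //; exact: le0x.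
Qed.

Lemma loc_power_minimal :
  (forall q, prime_elt q -> q <= m -> q = m) -> exists n, m ^+ n <= loc m \bot.
Proof.
move=> mmin; have [s [sp sE]] := principal_factorization principal_bot.
exists (size [seq y <- s | y <= m]); rewrite -prod_const.
  by rewrite sE; exact: loc_prod_filter.
by move=> y; rewrite mem_filter => /andP[ym ys]; apply: mmin => //; exact: sp.
Qed.

(** For principal [z], the prime factors below [m] either include a locally zero one or all equal
    [m]. A general [x] is governed by the least exponent of a power of [m] locally below it, if
    there is one. *)
Lemma loc_power x :
  (exists n, x <= loc m (m ^+ n) /\ m ^+ n <= loc m x) \/ x <= loc m \bot.
Proof.
have dich z : principal_elt z -> z <= loc m \bot \/
    exists n, z <= m ^+ n /\ m ^+ n <= loc m z.
  move=> pz; have [s [sp zE]] := principal_factorization pz.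
  have [[P [Ps Pm P0]]|nP] := pselect (exists P, [/\ P \in s, P <= m & P <= loc m \bot]).
    by left; apply: le_trans P0; rewrite zE prod_le.
  right; exists (size [seq y <- s | y <= m]); rewrite -prod_const => [|y].
    by rewrite zE; split; [exact: le_prod_filter|exact: loc_prod_filter].
  rewrite mem_filter => /andP[ym ys]; have yp := sp y ys.
  have [|[P [_ Pm _ P0 PE]]] := loc_structure; first exact.
  by case: (PE y yp ym) => // yP; case: nP; exists y; rewrite yP in ys ym *.
have [[n nx]|nn] := pselect (exists n, m ^+ n <= loc m x); last first.
  right; apply: le_principal => z pz zx; have [//|[n [_ nz]]] := dich z pz.
  by case: nn; exists n; apply: (loc_trans mp nz); exact: loc_le.
left; have exn : exists n, m ^+ n <= loc m x by exists n.
have [k kx kmin] := ex_minnP exn; exists k; split=> //.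
apply: le_principal => z pz zx; have [z0|[j [zj jz]]] := dich z pz.
  by apply: (loc_trans mp z0); apply: loc_le => //; exact: le0x.
apply: loc_le => //; apply: (le_trans zj); apply: le_exp; apply: kmin.
by apply: (loc_trans mp jz); exact: loc_le.
Qed.

End Local.


(** * Assembly of the local data into a global factorization *)

Lemma le_local x y : (forall m, maximal_elt m -> x <= loc m y) -> x <= y.
Proof.
move=> xy; apply: le_principal => e pe ex; rewrite -[e]mul1g -residualP.
have [->//|/eqP/properP /maximal_above [m mm rm]] := eqVneq (residual y e) 1.
by have /(principal_le_loc (maximal_prime mm) _ pe) := le_trans ex (xy m mm).
Qed.

(** For each [P] in [s] not above [x], take a principal [f <= x] not below [P]: a maximal element
    above [x] with no primes below it but [P] and itself is a prime factor of [f]. Maximal elements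
    that are minimal primes occur in [s]. *)
Lemma relevant_maximals x : exists U : seq L, forall m, maximal_elt m -> x <= m ->
  m \in U \/ exists P, [/\ minimal_prime P, P <= m, P <> m, x <= P & P <= loc m \bot].
Proof.
have [s [_ smin]] := minimal_prime_factors.
have [U UP] : exists U : seq L, forall P, P \in s -> ~ x <= P -> forall m, prime_elt m ->
    x <= m -> (forall q, prime_elt q -> q <= m -> q = P \/ q = m) -> m \in U.
  elim: (s) => [|P s' [U UP]]; first by exists [::].
  have [xP|/negP nxP] := boolP (x <= P).
    exists U => Q; rewrite inE => /orP[/eqP -> //|]; exact: UP.
  have [f [pf fx fP]] := nle_principal nxP.
  have [t [tp fE]] := principal_factorization pf.
  exists (t ++ U) => Q; rewrite inE => /orP[/eqP -> _ m mp xm mP|Qs' nxQ m mp xm mQ].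
    have [|r rt rm] := prime_prod (s := t) mp; first by rewrite -fE (le_trans fx).
    have [rP|<-] := mP r (tp r rt) rm; last by rewrite mem_cat rt.
    by case: fP; rewrite fE -rP prod_le.
  by rewrite mem_cat (UP Q Qs') ?orbT.
exists (s ++ U) => m mm xm; have mp := maximal_prime mm; rewrite mem_cat.
have [mmin|[P [Pmin Pm Pnm P0 PE]]] := loc_structure mp.
  by left; have [P [Ps [Pp _] Pm]] := smin m mp; rewrite -(mmin P Pp Pm) Ps.
have [xP|/negP nxP] := boolP (x <= P); first by right; exists P.
have [Q [Qs Qmin QP]] := smin P Pmin.1.
by left; rewrite (UP P) ?orbT //; rewrite -(Pmin.2 Q Qmin.1 QP).
Qed.

(* [x] is the product of the powers [m ^+ n m] to which it localizes, together
   with the minimal primes above it that are not maximal. *)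
Lemma prime_factorization x : has_factorization prime_elt x.
Proof.
have [U UP] := relevant_maximals x.
have [s [sp smin]] := minimal_prime_factors.
pose power m n := x <= loc m (m ^+ n) /\ m ^+ n <= loc m x.
(* Where no exponent exists [n] takes an arbitrary value; at a maximal element of this kind both
   sides of the factorization vanish locally. *)
have [n nP] : exists n : L -> nat, forall m, (exists k, power m k) -> power m (n m).
  have [|n nP] := choice (P := fun m k => (exists k, power m k) -> power m k).
    move=> m; have [[k mk]|nk] := pselect (exists k, power m k); first by exists k.
    by exists 0%N.
  by exists n.
(* [undup] matters: once [m] is removed from [M], no remaining member may lie below [m]. *)
pose M := [seq m <- undup U | `[< maximal_elt m >] && (x <= m)].
pose N := [seq P <- s | ~~ `[< maximal_elt P >] && (x <= P)].
have MP m : m \in M -> maximal_elt m /\ x <= m.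
  by rewrite mem_filter => /andP[/andP[/asboolP]].
have NP P : P \in N -> [/\ P \in s, ~ maximal_elt P & x <= P].
  by rewrite mem_filter => /andP[/andP[/asboolP]].
pose F (t : seq L) := \Pi [seq m ^+ n m | m <- t].
suff -> : x = F M * \Pi N.
  apply: has_factorizationM; last first.
    by exists N; split=> // P /NP [/sp].
  have : forall m, m \in M -> prime_elt m by move=> m /MP [/maximal_prime].
  rewrite /F; elim: M {MP} => [|m t IHt] tp; first by rewrite big_nil; exact: has_factorization1.
  rewrite /= prod_cons; apply: has_factorizationM.
    by apply: has_factorizationX; apply: has_factorizationW; apply: tp; exact: mem_head.
  by apply: IHt => r rt; apply: tp; rewrite inE rt orbT.
have FP p t : prime_elt p -> F t <= p -> exists2 r, r \in t & r <= p.
  by move=> pp /(prime_prod pp) [_ /mapP[r rt ->] /(prime_exp pp)]; exists r.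
suff loc_eq m : maximal_elt m -> x <= loc m (F M * \Pi N) /\ F M * \Pi N <= loc m x.
  by apply/le_anti/andP; split; apply: le_local => m /loc_eq [].
move=> mm; have mp := maximal_prime mm.
have [xm|/negP nxm] := boolP (x <= m); last first.
  suff ny : ~ F M * \Pi N <= m.
    split; first by apply: (loc_trans mp (loc_unit _ ny)); apply: loc_le => //; exact: mul_ler.
    by apply: (loc_trans mp (loc_unit _ nxm)); apply: loc_le => //; exact: mul_ler.
  move=> /mp.2 [/(FP _ _ mp) [r /MP [_ xr] rm]|/(prime_prod mp) [r /NP [_ _ xr] rm]];
    by apply: nxm; exact: le_trans rm.
(* In the first case the locally zero [P] is a factor in [N], so both sides vanish locally. *)
have [[P [Pmin Pm Pnm xP P0]]|nQ] := pselect
    (exists P, [/\ minimal_prime P, P <= m, P <> m, x <= P & P <= loc m \bot]).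
  have le0loc y : \bot <= loc m y by exact: le0x.
  have PN : P \in N.
    have [Q [Qs Qmin QP]] := smin P Pmin.1; rewrite -(Pmin.2 Q Qmin.1 QP) mem_filter Qs andbT.
    rewrite (Pmin.2 Q Qmin.1 QP) xP andbT; apply/asboolPn => Pmax; apply: Pnm.
    by rewrite (maximal_le Pmax mm.1 Pm).
  split; first by apply: (loc_trans mp (le_trans xP P0)); apply: loc_le => //; exact: le0x.
  apply: (loc_trans mp (b := \bot)); last by apply: loc_le => //; exact: le0x.
  by apply: le_trans P0; apply: le_trans (mul_ler _ _) (prod_le PN).
have mU : m \in U by have [//|] := UP m mm xm.
have mM : m \in M.
  by rewrite mem_filter mem_undup mU andbT xm andbT; apply/asboolP.
have FE : F M = m ^+ n m * F (rem m M).
  have : uniq M by rewrite filter_uniq // undup_uniq.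
  rewrite /F => _; elim: (M) mM => //= r t IHt; rewrite inE prod_cons.
  have [-> //|ne] := eqVneq r m; move=> /= /IHt ->.
  by rewrite /= prod_cons !mulgA (mulLC (m ^+ n m)).
have nrest : ~ F (rem m M) * \Pi N <= m.
  move=> /mp.2 [/(FP _ _ mp) [r]|/(prime_prod mp) [P /NP [Ps Pnmax xP] Pm]].
    have Muniq : uniq M by rewrite filter_uniq // undup_uniq.
    rewrite (mem_rem_uniq m Muniq) inE => /andP[/eqP rm /MP [rmax _]] /(maximal_le rmax mm.1).
    by move=> mr; apply: rm.
  have [mmin|[Q [Qmin Qm Qnm Q0 QE]]] := loc_structure mp.
    by apply: Pnmax; rewrite (mmin P (sp P Ps) Pm).
  have [PQ|PE] := QE P (sp P Ps) Pm; last by apply: Pnmax; rewrite PE.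
  by apply: nQ; exists Q; split=> //; rewrite -PQ.
(* A locally zero [x] still has an exponent: [nQ] leaves only the case where [m] is a minimal prime,
   and then some power of [m] vanishes locally. *)
have [xn nx] : power m (n m).
  apply: nP; have [//|x0] := loc_power mp x.
  have x0le y : x <= loc m y.
    by apply: (loc_trans mp x0); apply: loc_le => //; exact: le0x.
  have [mmin|[Q [Qmin Qm Qnm Q0 _]]] := loc_structure mp.
    have [k mk] := loc_power_minimal mp mmin; exists k; split=> //.
    by apply: (loc_trans mp mk); apply: loc_le => //; exact: le0x.
  by case: nQ; exists Q; split=> //; apply: (loc_prime mp Qmin.1 Qm).
rewrite FE -mulgA; split.
  by apply: (loc_trans mp xn); exact: loc_unit.
by apply: (loc_trans mp _ nx); apply: loc_le => //; exact: mul_lel.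
Qed.

End PrimeFactorization.

(** Take [a * b <= x] with neither factor below [x]. For proper [c], the OA property of [c * a * b]
    gives [c * a <= x], and that of [c1 * c2 * a] gives [c1 * c2 <= x]. If [c1] and [c2] joined to
    1, then [a] would be below [x]. *)
Lemma OA_cases x : OA_elt x -> prime_elt x \/
  forall c1 c2, proper_elt c1 -> proper_elt c2 -> proper_elt (c1 `|` c2) /\ c1 * c2 <= x.
Proof.
move=> [x1 xOA]; have [xp|xnp] := pselect (prime_elt x); [by left|right].
have [a [b [abx ax bx]]] : exists a b, [/\ a * b <= x, ~ a <= x & ~ b <= x].
  apply: contrapT => nab; apply: xnp; split=> // a b abx; apply: contrapT => /not_orP[ax bx].
  by apply: nab; exists a, b.
have a1 : a <> 1 by move=> aE; apply: bx; rewrite -[b]mul1g -aE.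
have b1 : b <> 1 by move=> bE; apply: ax; rewrite -[a]mulg1 -bE.
have cax c : proper_elt c -> c * a <= x.
  move=> /properP c1; have [|//|//] := xOA c a b c1 a1 b1.
  by rewrite -mulgA (le_trans (mul_ler _ _)).
move=> c1 c2 c1p c2p; split.
  by apply/properP => cE; apply: ax; rewrite -[a]mul1g -cE mulUl leUx !cax.
have [|//|//] := xOA c1 c2 a (proj1 (properP c1) c1p) (proj1 (properP c2) c2p) a1.
by rewrite -mulgA (le_trans (mul_ler _ _)) // cax.
Qed.

(** * The quasi-local case, where every proper element lies below [m] *)

Section Local.
Context (m : L) (mm : maximal_elt m) (mtop : forall a, proper_elt a -> a <= m).
Let mp : prime_elt m := maximal_prime mm.

Lemma local_le a b : a <= loc m b -> a <= b.
Proof.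
move=> /(le_locP mp) ab; apply: le_principal => e pe ea.
rewrite -[e]mul1g -residualP.
by have [->//|/eqP/properP /mtop /(ab e pe ea)] := eqVneq (residual b e) 1.
Qed.

Lemma Nakayama f x : principal_elt f -> x <= m -> f <= x * f -> f = \bot.
Proof.
move=> pf xm fxf; apply/eqP; rewrite -lex0; apply: local_le.
by apply: (loc_Nakayama0 mp pf xm); exact: loc_le.
Qed.

Lemma jacobson_local : jacobson L = m.
Proof.
apply/le_anti/andP; split; first exact: lmeet_lb.
by apply: le_lmeet => x xm; rewrite (maximal_le xm mm.1) // mtop //; exact: xm.1.
Qed.

Lemma quasi_local_local : quasi_local L.
Proof.
split; first exact: compact_one.
by exists m; split=> // x xm; rewrite (maximal_le xm mm.1) // mtop //; exact: xm.1.
Qed.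

Lemma OA_above_square x : proper_elt x -> m * m <= x -> OA_elt x.
Proof.
move=> x1 mmx; split=> // a b c /properP /mtop am /properP /mtop bm _ _; left.
exact: le_trans (le_mul am bm) mmx.
Qed.

(** As [e] is not below [m * m], the cofactor of [m * m] over [e] is proper, hence below [m]. This
    gives [m * m = m * e], and induction does the rest. *)
Lemma power_principal e n : principal_elt e -> e <= m -> m * m <= e -> ~ e <= m * m ->
  m ^+ n.+1 = m * e ^+ n.
Proof.
move=> pe em me nem.
have mmE : m * m = m * e.
  apply/le_anti/andP; split; last exact: le_mul2l.
  rewrite {1}(principal_le pe me) le_mul2r //.
  by apply: mtop; apply/properP => r1; apply: nem; rewrite -[e]mul1g -residualP r1.
elim: n => [|n IHn]; first by rewrite mulg1.
by rewrite expgS IHn mulgA mmE -mulgA -expgS.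
Qed.

(** Take the last power of [m] above [x]. If its exponent is at least 2, divide [x] by the power of
    a principal [e] with exponent one less; the quotient escapes [m * m], so it is 1 or an
    OA-element. *)
Lemma local_OA_factorization :
  comparable_elt (m ^+ 2) -> has_OA_factorization (\bot : L) ->
  (forall x, (forall n, x <= m ^+ n) -> x = \bot) ->
  forall x, has_OA_factorization x.
Proof.
rewrite expg2 => cmp bot_fact inter x.
have [->//|nx] := pselect (x = \bot).
have exn : exists n, ~~ (x <= m ^+ n).
  apply: contrapT => nn; apply: nx; apply: inter => n; apply: contrapT => /negP xn.
  by apply: nn; exists n.
have [[|k] xk kmin] := ex_minnP exn; first by rewrite lex1g in xk.
have {kmin} xmk : x <= m ^+ k.
  by apply: contrapT => /negP /kmin; rewrite ltnn.
have [x1|/eqP/properP xprop] := eqVneq x 1.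
  by rewrite x1; exact: has_factorization1.
case: k xk xmk => [|[|k]] xk xmk.
- by rewrite expg1 mtop in xk.
- apply: has_factorizationW; apply: OA_above_square => //.
  by have [//|] := cmp x; rewrite -expg2 (negPf xk).
have [|e [pe em nem]] := @nle_principal m (m * m).
  move=> mmm; move/negP: xk; apply; apply: le_trans xmk _.
  by rewrite (expgS m k.+2) (expgS m k.+1) mulgA le_mul2r.
have me : m * m <= e by have [] := cmp e.
have eOA : OA_elt e by apply: OA_above_square => //; exact: le_lt_trans em mm.1.
have xe : x <= e ^+ k.+1.
  by apply: le_trans xmk _; rewrite (power_principal _ pe) // mul_ler.
have pek := principal_exp k.+1 pe.
rewrite (principal_le pek xe); set y := residual _ _.
apply: has_factorizationM; last exact/has_factorizationX/has_factorizationW.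
have [->|/eqP/properP y1] := eqVneq y 1; first exact: has_factorization1.
apply: has_factorizationW; apply: OA_above_square => //.
have [//|ymm] := cmp y; move/negP: xk; case.
rewrite expgS (power_principal _ pe) // mulgA (principal_le pek xe); exact: le_mul2r.
Qed.

Context (H3 : forall a b, principal_elt a -> principal_elt b ->
  has_OA_factorization (a `|` b)).
Context (OAP : forall x, OA_elt x -> prime_elt x \/ m * m <= x) (nidem : ~ m <= m * m).

(** Two or more factors would put [z] below [m * m], so [z] is itself an OA-element. *)
Lemma OA_outside_square z : has_OA_factorization z -> proper_elt z -> ~ z <= m * m ->
  prime_elt z \/ m * m <= z.
Proof.
move=> [[|x [|y s]] [sOA ->]]; first by rewrite big_nil => /properP.
  by rewrite prod_cons big_nil mulg1 => _ _; apply/OAP/sOA; rewrite mem_head.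
move=> _ []; rewrite !prod_cons mulgA; apply: le_trans (mul_lel _ _) _.
by apply: le_mul; apply: mtop; apply: (sOA _ _).1; rewrite !inE eqxx ?orbT.
Qed.

(** If [e] is prime and some principal [f <= m] is not below [e], the join of [e] and [f * (f * f)]
    is prime or above [m * m], hence above [f] or [f * f]. As [residual e g = e] for [g] not below
    [e], dividing by that element would put 1 below [m]. *)
Lemma square_le_principal e : principal_elt e -> ~ e <= m * m -> m * m <= e.
Proof.
move=> pe nem; have [->|/eqP/properP e1] := eqVneq e 1; first exact: lex1g.
have em := mtop e1.
have [|ep|//] := OA_outside_square _ e1 nem.
  by rewrite -[e](joinxx e); exact: H3.
have [me|/negP/nle_principal [f [pf fm fe]]] := boolP (m <= e).
  exact: le_trans (mul_lel _ _) me.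
have pff := principal_mul pf pf; have ffe : ~ f * f <= e by move/ep.2 => [].
have res_prime g : ~ g <= e -> residual e g = e.
  move=> ge; apply/le_anti; rewrite le_residual andbT.
  by apply: (prime_mul ep _ ge); rewrite mulLC residual_mul.
have absurd g h : principal_elt g -> ~ g <= e -> h <= m -> ~ g <= e `|` h * g.
  move=> pg ge hm ghg; apply: (prime_neq1 mp).
  have := residual_eq1 ghg; rewrite principal_residual // res_prime // => <-.
  by rewrite leUx em.
have [|||ffp|mmff] := @OA_outside_square (e `|` f * (f * f)).
- by apply: H3 => //; exact: principal_mul.
- by apply: le_lt_trans _ mm.1; rewrite leUx em (le_trans (mul_lel _ _)).
- by rewrite leUx => /andP[].
- case: (absurd f (f * f) pf fe); first by rewrite (le_trans (mul_lel _ _)).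
  rewrite -mulgA; have : f * (f * f) <= e `|` f * (f * f) by exact: leUr.
  by case/ffp.2 => // /ffp.2 [].
- case: (absurd (f * f) f pff ffe fm); apply: le_trans mmff; exact: le_mul.
Qed.

Lemma square_comparable : comparable_elt (m ^+ 2).
Proof.
rewrite expg2 => b; have [bm|/negP/nle_principal [e [pe eb nem]]] := boolP (b <= m * m).
  by right.
by left; apply: le_trans (square_le_principal pe nem) eb.
Qed.

(** An OA-factor not above [m * m] would be a prime [y <= m * m <= e]; then [y <= e * y], so
    [f <= e * f] and Nakayama's lemma kills [f]. Thus each factor of [f] contributes 2 to the
    exponent. *)
Lemma power_le_principal f : principal_elt f -> f <> \bot -> exists n, m ^+ n <= f.
Proof.
move=> pf f0; have [e [pe em nem]] := nle_principal nidem.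
have me := square_le_principal pe nem.
have [s [sOA fE]] : has_OA_factorization f by rewrite -[f](joinxx f); exact: H3.
have mmy y : y \in s -> m * m <= y.
  move=> ys; have [yp|//] := OAP (sOA y ys).
  have := square_comparable y; rewrite expg2 => -[//|ymm].
  have [//|nmy] := pselect (m * m <= y); case: f0; apply: (Nakayama pf em).
  have ye : y <= e := le_trans ymm me.
  have ey : ~ e <= y by move=> ey; apply: nmy; exact: le_trans ey.
  have yE : y <= e * y.
    rewrite {1}(principal_le pe ye) mulLC le_mul2l //.
    by apply: (prime_mul yp _ ey); rewrite mulLC residual_mul.
  by rewrite fE (prod_rem ys) mulgA; exact: le_mul2r.
exists (2 * size s)%N; rewrite fE expgnA expg2.
elim: (s) mmy => [|y t IHt] mmy; first by rewrite big_nil.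
rewrite prod_cons expgS; apply: le_mul; first by apply: mmy; exact: mem_head.
by apply: IHt => z zt; apply: mmy; rewrite inE zt orbT.
Qed.

(** Nonzero principal elements dominate powers of [m]. Hence zero divisors make [m] nilpotent, and a
    nonzero principal [f] below all powers would satisfy [f <= m ^+ n.+1 <= m * f]. *)
Lemma nilpotent_or_domain : nilpotent_elt m \/
  lattice_domain L /\ lmeet (range (fun n : nat => m ^+ n)) = \bot.
Proof.
have [mnil|nnil] := pselect (nilpotent_elt m); [by left|right; split].
  split; first exact: le_lt_trans (le0x m) mm.1.
  move=> a b ab0; apply: contrapT => /not_orP[/nle_principal [e [pe ea e0]]].
  move=> /nle_principal [f [pf fb f0]].
  have [k ke] := power_le_principal pe (fun eE => e0 (eq_ind_r (fun z => z <= \bot) (lexx _) eE)).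
  have [n nf] := power_le_principal pf (fun eE => f0 (eq_ind_r (fun z => z <= \bot) (lexx _) eE)).
  apply: nnil; exists (k + n)%N; apply/eqP; rewrite -lex0 expgnDr.
  by apply: le_trans (le_mul ke nf) (le_trans (le_mul ea fb) ab0).
apply/eqP; rewrite -lex0; apply: le_principal => f pf fm.
suff -> : f = \bot by exact: lexx.
apply: contrapT => f0; have [n nf] := power_le_principal pf f0.
apply: f0; apply: (Nakayama pf (lexx m)).
apply: (le_trans fm); apply: (@le_trans _ _ (m ^+ n.+1)); first by apply: lmeet_lb; exists n.+1.
by rewrite expgS le_mul2l.
Qed.

End Local.

End PrincipallyGenerated.

Theorem theorem4p13 (d : Order.disp_t) (L : multLatticeType d)
    (HC : C_lattice L) (Hpg : principally_generated L) :
  let m : L := jacobson L in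
  [<-> OAFL L;
       COAFL L;
       forall a b : L, principal_elt a -> principal_elt b ->
         has_OA_factorization (a `|` b);
       [\/ ZPI_lattice L,
           [/\ quasi_local L, comparable_elt (m ^+ 2) & nilpotent_elt m] |
           [/\ quasi_local L, lattice_domain L, comparable_elt (m ^+ 2) &
               lmeet (range (fun n : nat => m ^+ n)) = \bot]]].
Proof.
move=> m; tfae.
- by move=> [_ fact]; split=> // x _; exact: fact.
- move=> [_ fact] a b pa pb; apply: fact => F abF.
  exact: (compact_join (principal_compact HC pa) (principal_compact HC pb)).
- move=> H3.
  have [allprime|/existsNP[x0 /not_implyP[x0OA x0np]]] :=
      pselect (forall x : L, OA_elt x -> prime_elt x).
    apply: Or31 => x; apply: (prime_factorization HC Hpg) => a b pa pb.
    have [s [sOA ->]] := H3 a b pa pb.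
    by exists s; split=> // y /sOA; exact: allprime.
  have [//|x0P] := OA_cases x0OA.
  have [m' mm x0m] := maximal_above HC x0OA.1.
  have mtop (a : L) : proper_elt a -> a <= m'.
    move=> a1; have [am1 _] := x0P a m' a1 mm.1.
    by rewrite -(maximal_le mm am1) ?leUl ?leUr.
  have OAP (x : L) : OA_elt x -> prime_elt x \/ m' * m' <= x.
    move=> /OA_cases [xp|xP]; [by left|right].
    by have [] := xP m' m' mm.1 mm.1.
  (* If [m'] were idempotent, [x0] would lie between [m' * m'] and [m'], hence equal the prime
     [m']. *)
  have nidem : ~ m' <= m' * m'.
    move=> mmm; apply: x0np; have [_ mx0] := x0P m' m' mm.1 mm.1.
    suff -> : x0 = m' by exact: maximal_prime.
    by apply/le_anti; rewrite x0m (le_trans mmm).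
  have mE : m = m' := jacobson_local mm mtop.
  have ql := quasi_local_local HC mm mtop.
  have cmp := square_comparable Hpg mm mtop H3 OAP.
  rewrite mE; have [mnil|[dom inter]] := nilpotent_or_domain HC Hpg mm mtop H3 OAP nidem.
    by apply: Or32.
  by apply: Or33.
- move=> zab; split=> //.
  have local_case : quasi_local L -> [/\ maximal_elt m & forall a : L, proper_elt a -> a <= m].
    move=> [_ [m' [mm muniq]]].
    have mtop (a : L) : proper_elt a -> a <= m'.
      by move=> a1; have [m2 /muniq <-] := maximal_above HC a1.
    by rewrite /m (jacobson_local mm mtop).
  case: zab => [zpi|[ql cmp [n mn]]|[ql dom cmp inter]].
  + move=> x; have [s [sp ->]] := zpi x; exists s; split=> // y /sp; exact: prime_OA.
  + have [mm mtop] := local_case ql.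
    apply: (local_OA_factorization Hpg mm mtop cmp) => [|x xm].
      rewrite -mn; apply/has_factorizationX/has_factorizationW/prime_OA.
      exact: maximal_prime.
    by apply/eqP; rewrite -lex0 -mn.
  + have [mm mtop] := local_case ql.
    apply: (local_OA_factorization Hpg mm mtop cmp) => [|x xm].
      exact/has_factorizationW/prime_OA.
    by apply/eqP; rewrite -lex0 -inter; apply: le_lmeet => _ [n _ <-].
Qed.
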